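(* Let $\mathcal{O}$ be a Dedekind domain. For a co-torsion $\mathcal{O}$-submodule $M\subsetneq \mathcal{O}^2$, the invariant factor ideals $\mathcal{L}\supseteq \mathcal{K}$ of $M$ together with the projective space invariant element $[a:b]\in \mathbb{PF}^1_{\mathcal{I}}$ of $M$, where $\mathcal{K}=\mathcal{L}\mathcal{I}$, completely determine $M$ as a subset of $\mathcal{O}^2$. In other words: if $M_1,M_2\subsetneq \mathcal{O}^2$ are two co-torsion $\mathcal{O}$-submodules with invariant factor ideals $\mathcal{L}_i\supseteq \mathcal{K}_i$ and projective space invariant elements $[a_i:b_i]\in \mathbb{PF}^1_{\mathcal{I}_i}$, where $\mathcal{K}_i=\mathcal{L}_i\mathcal{I}_i$, $i=1,2$, then $$M_1=M_2 \iff \mathcal{L}_1=\mathcal{L}_2,\ \mathcal{K}_1=\mathcal{K}_2 \text{ and } [a_1:b_1]=[a_2:b_2]\in \mathbb{PF}^1_{\mathcal{J}}, \text{ where } \mathcal{J}=\mathcal{I}_1=\mathcal{I}_2.$$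
   Context: An $\mathcal{O}$-submodule $M\subseteq \mathcal{O}^2$ is co-torsion if $\mathcal{O}^2/M$ is a torsion $\mathcal{O}$-module. Projective space: let $(\mathcal{O}^2)^{*}=\{(a,b)\in \mathcal{O}^2\mid \langle a\rangle +\langle b\rangle = \mathcal{O}\}$. For an ideal $\mathcal{I}\subseteq\mathcal{O}$, define the equivalence relation on $(\mathcal{O}^2)^*$ by $(a,b)\sim (c,d)$ iff $ad-bc\in \mathcal{I}$. Then $\mathbb{PF}^1_{\mathcal{I}}=(\mathcal{O}^2)^{*}/\sim$, and the class of $(a,b)$ is denoted $[a:b]$. Invariants of a co-torsion submodule $M\subsetneq\mathcal{O}^2$: there are finitely many distinct maximal ideals $\mathcal{M}_1,\dots,\mathcal{M}_r$ of $\mathcal{O}$ (the elementary maximal ideal divisors) and integers $0\le l_i\le k_i\ne 0$, $1\le i\le r$, with $\mathcal{O}^2/M\cong\bigoplus_{i=1}^r\big(\mathcal{O}/\mathcal{M}_i^{l_i}\oplus\mathcal{O}/\mathcal{M}_i^{k_i}\big)$. The invariant factor ideals are $\mathcal{L}=\prod_{i=1}^r\mathcal{M}_i^{l_i}\supseteq\mathcal{K}=\prod_{i=1}^r\mathcal{M}_i^{k_i}$, so that $\mathcal{O}^2/M\cong\mathcal{O}/\mathcal{L}\oplus\mathcal{O}/\mathcal{K}$. The projective space invariant ideal is $\mathcal{I}=\prod_{i=1}^r\mathcal{M}_i^{k_i-l_i}$, so $\mathcal{K}=\mathcal{L}\mathcal{I}$. The projective space invariant element of $M$ is the class $[a:b]\in\mathbb{PF}^1_{\mathcal{I}}$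 of any $(a,b)\in(\mathcal{O}^2)^*$ for which there is $t\in\mathcal{L}\setminus\bigcup_{i=1}^r\mathcal{L}\mathcal{M}_i$ with $(ta,tb)\in M$; such a pair exists and its class in $\mathbb{PF}^1_{\mathcal{I}}$ depends only on $M$. *)

(* Defs.v *)
From HB Require Import structures.
From mathcomp Require Import all_boot all_order all_algebra.
From mathcomp Require Import ring boolp classical_sets.

Set Implicit Arguments.
Unset Strict Implicit.
Unset Printing Implicit Defensive.

Import GRing.Theory.
Local Open Scope ring_scope.
Local Open Scope quotient_scope.
Local Open Scope classical_set_scope.

(* Submodules of V are terms of the library type submodClosed V.  They are
   compared with =i, so that equality means equality as subsets. *)

Section QuotientModule.
Variables (R : pzRingType) (V : lmodType R) (M : submodClosed V).

Lemma submod_oppr_closed : oppr_closed M.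
Proof. by move=> x xM; rewrite -scaleN1r rpredZ. Qed.

(* submodClosed does not inherit from zmodClosed, which Quotient.quot needs. *)
Definition submod_zmod : zmodClosed V :=
  HB.pack (GRing.SubmodClosed.sort M) (GRing.isOppClosed.Build V M submod_oppr_closed).

Definition quotmod : Type := Quotient.quot submod_zmod.
HB.instance Definition _ := GRing.Zmodule.on quotmod.

Definition quotmod_pi (x : V) : quotmod := \pi_(Quotient.quot submod_zmod) x.

Definition quotmod_scale (a : R) (x : quotmod) : quotmod :=
  quotmod_pi (a *: repr (x : Quotient.quot submod_zmod)).

Lemma quotmod_piE x y : quotmod_pi x = quotmod_pi y <-> x - y \in M.
Proof.
rewrite -[x - y \in M]/(Quotient.equiv submod_zmod x y) Quotient.equivE.
by rewrite Quotient.idealrBE; split=> [/eqP|/eqP].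
Qed.

Lemma quotmod_piP (x : quotmod) : exists v, x = quotmod_pi v.
Proof.
exists (repr (x : Quotient.quot submod_zmod)).
by rewrite /quotmod_pi reprK.
Qed.

Lemma quotmod_piD x y : quotmod_pi (x + y) = quotmod_pi x + quotmod_pi y.
Proof. exact: raddfD. Qed.

Lemma quotmod_scaleE a x : quotmod_scale a (quotmod_pi x) = quotmod_pi (a *: x).
Proof.
apply/quotmod_piE; rewrite -scalerBr rpredZ //.
by apply/quotmod_piE; rewrite /quotmod_pi reprK.
Qed.

Lemma quotmod_scaleA a b x :
  quotmod_scale a (quotmod_scale b x) = quotmod_scale (a * b) x.
Proof.
by have [v ->] := quotmod_piP x; rewrite !quotmod_scaleE scalerA.
Qed.

Lemma quotmod_scale1 : left_id 1 quotmod_scale.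
Proof.
by move=> x; have [v ->] := quotmod_piP x; rewrite quotmod_scaleE scale1r.
Qed.

Lemma quotmod_scaleDr : right_distributive quotmod_scale +%R.
Proof.
move=> a x y; have [v ->] := quotmod_piP x; have [w ->] := quotmod_piP y.
by rewrite -quotmod_piD !quotmod_scaleE scalerDr quotmod_piD.
Qed.

Lemma quotmod_scaleDl x : {morph quotmod_scale^~ x : a b / a + b}.
Proof.
move=> a b; have [v ->] := quotmod_piP x.
by rewrite !quotmod_scaleE scalerDl quotmod_piD.
Qed.

HB.instance Definition _ := GRing.Zmodule_isLmodule.Build R quotmod
  quotmod_scaleA quotmod_scale1 quotmod_scaleDr quotmod_scaleDl.

End QuotientModule.

(* The direct sum of a finite family of modules, as a dependent product. *)
Section DirectSum.
Variables (R : pzRingType) (I : finType) (F : I -> lmodType R).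

Definition dirsum : Type := {dffun forall i, F i}.
HB.instance Definition _ := Choice.on dirsum.

Definition dirsum_mk (f : forall i, F i) : dirsum :=
  [ffun i => f i] : {dffun forall i, F i}.
Definition dirsum_coord (x : dirsum) (i : I) : F i :=
  (x : {dffun forall i, F i}) i.

Lemma dirsum_mkE f i : dirsum_coord (dirsum_mk f) i = f i.
Proof. by rewrite /dirsum_coord ffunE. Qed.

Lemma dirsumP (x y : dirsum) :
  (forall i, dirsum_coord x i = dirsum_coord y i) -> x = y.
Proof. by move=> xy; apply/ffunP. Qed.

Definition dirsum_zero := dirsum_mk (fun _ => 0).
Definition dirsum_opp x := dirsum_mk (fun i => - dirsum_coord x i).
Definition dirsum_add x y :=
  dirsum_mk (fun i => dirsum_coord x i + dirsum_coord y i).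
Definition dirsum_scale a x := dirsum_mk (fun i => a *: dirsum_coord x i).

Lemma dirsum_addA : associative dirsum_add.
Proof. by move=> x y z; apply: dirsumP => i; rewrite !dirsum_mkE addrA. Qed.
Lemma dirsum_addC : commutative dirsum_add.
Proof. by move=> x y; apply: dirsumP => i; rewrite !dirsum_mkE addrC. Qed.
Lemma dirsum_add0 : left_id dirsum_zero dirsum_add.
Proof. by move=> x; apply: dirsumP => i; rewrite !dirsum_mkE add0r. Qed.
Lemma dirsum_addN : left_inverse dirsum_zero dirsum_opp dirsum_add.
Proof. by move=> x; apply: dirsumP => i; rewrite !dirsum_mkE addNr. Qed.

HB.instance Definition _ := GRing.isZmodule.Build dirsum
  dirsum_addA dirsum_addC dirsum_add0 dirsum_addN.

Lemma dirsum_scaleA a b x :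
  dirsum_scale a (dirsum_scale b x) = dirsum_scale (a * b) x.
Proof. by apply: dirsumP => i; rewrite !dirsum_mkE scalerA. Qed.
Lemma dirsum_scale1 : left_id 1 dirsum_scale.
Proof. by move=> x; apply: dirsumP => i; rewrite !dirsum_mkE scale1r. Qed.
Lemma dirsum_scaleDr : right_distributive dirsum_scale +%R.
Proof. by move=> a x y; apply: dirsumP => i; rewrite !dirsum_mkE scalerDr. Qed.
Lemma dirsum_scaleDl x : {morph dirsum_scale^~ x : a b / a + b}.
Proof. by move=> a b; apply: dirsumP => i; rewrite !dirsum_mkE scalerDl. Qed.

HB.instance Definition _ := GRing.Zmodule_isLmodule.Build R dirsum
  dirsum_scaleA dirsum_scale1 dirsum_scaleDr dirsum_scaleDl.

End DirectSum.

Definition lmod_isomorphic (R : pzRingType) (U V : lmodType R) : Prop :=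
  exists f : {linear U -> V}, bijective f.

Definition proper_submod (R : pzRingType) (V : lmodType R)
    (M : submodClosed V) : Prop :=
  exists x, x \notin M.

Definition torsion_module (R : pzRingType) (V : lmodType R) : Prop :=
  forall v : V, exists2 a : R, a != 0 & a *: v = 0.

Definition cotorsion (R : pzRingType) (V : lmodType R)
    (M : submodClosed V) : Prop :=
  torsion_module (quotmod M).

(* Ideals are the submodules of the regular module; unlike the library's
   idealr, the unit ideal is included. *)
Notation ideal O := (submodClosed O^o).

Section Ideals.
Variable O : comNzRingType.
Implicit Types I J P : ideal O.

Definition ideal0_pred (x : O^o) : bool := x == 0.
Lemma ideal0_closed : subsemimod_closed ideal0_pred.
Proof.
split; first split.
- exact: eqxx.
- by move=> x y /eqP-> /eqP->; apply/eqP; rewrite addr0.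
- by move=> a x /eqP->; apply/eqP; rewrite scaler0.
Qed.
HB.instance Definition _ :=
  GRing.isSubmodClosed.Build O O^o ideal0_pred ideal0_closed.
Definition ideal0 : ideal O :=
  GRing.SubmodClosed.clone O O^o ideal0_pred _.

Definition idealT_pred (x : O^o) : bool := true.
Lemma idealT_closed : subsemimod_closed idealT_pred.
Proof. by []. Qed.
HB.instance Definition _ :=
  GRing.isSubmodClosed.Build O O^o idealT_pred idealT_closed.
Definition idealT : ideal O :=
  GRing.SubmodClosed.clone O O^o idealT_pred _.

Definition principal_pred (a : O) (x : O^o) : bool :=
  `[< exists c : O, x = c * a >].
Lemma principal_closed a : subsemimod_closed (principal_pred a).
Proof.
split; first split.
- by apply/asboolP; exists 0; rewrite mul0r.
- move=> _ _ /asboolP[c ->] /asboolP[d ->].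
  by apply/asboolP; exists (c + d); rewrite mulrDl.
- by move=> b _ /asboolP[c ->]; apply/asboolP; exists (b * c); rewrite -mulrA.
Qed.
HB.instance Definition _ a :=
  GRing.isSubmodClosed.Build O O^o (principal_pred a) (principal_closed a).
Definition principal a : ideal O :=
  GRing.SubmodClosed.clone O O^o (principal_pred a) _.

Definition idealD_pred I J (x : O^o) : bool :=
  `[< exists u v : O, [/\ u \in I, v \in J & x = u + v] >].
Lemma idealD_closed I J : subsemimod_closed (idealD_pred I J).
Proof.
split; first split.
- apply/asboolP; exists 0, 0.
  by split; [exact: (rpred0 I) | exact: (rpred0 J) | rewrite addr0].
- move=> _ _ /asboolP[u [v [uI vJ ->]]] /asboolP[u' [v' [uI' vJ' ->]]].
  apply/asboolP; exists (u + u'), (v + v').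
  split; last exact: addrACA.
    exact: (@rpredD O^o I u u' uI uI').
  exact: (@rpredD O^o J v v' vJ vJ').
- move=> b _ /asboolP[u [v [uI vJ ->]]]; apply/asboolP.
  exists (b * u), (b * v); split; last exact: mulrDr.
    exact: (@rpredZ O O^o I b u uI).
  exact: (@rpredZ O O^o J b v vJ).
Qed.
HB.instance Definition _ I J :=
  GRing.isSubmodClosed.Build O O^o (idealD_pred I J) (idealD_closed I J).
Definition idealD I J : ideal O :=
  GRing.SubmodClosed.clone O O^o (idealD_pred I J) _.

Definition idealM_pred I J (x : O^o) : bool :=
  `[< exists s : seq (O * O), {in s, forall p, p.1 \in I /\ p.2 \in J} /\
        x = \sum_(p <- s) p.1 * p.2 >].
Lemma idealM_closed I J : subsemimod_closed (idealM_pred I J).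
Proof.
split; first split.
- by apply/asboolP; exists [::]; rewrite big_nil.
- move=> _ _ /asboolP[s [sIJ ->]] /asboolP[t [tIJ ->]].
  apply/asboolP; exists (s ++ t); rewrite big_cat; split=> // p.
  by rewrite mem_cat => /orP[/sIJ|/tIJ].
- move=> b _ /asboolP[s [sIJ ->]]; apply/asboolP.
  exists [seq (b * p.1, p.2) | p <- s]; split.
    move=> _ /mapP[p /sIJ[p1 p2] ->]; split=> //=.
    exact: (@rpredZ O O^o I b p.1 p1).
  rewrite big_map [LHS]mulr_sumr; apply: eq_bigr => p _; exact: mulrA.
Qed.
HB.instance Definition _ I J :=
  GRing.isSubmodClosed.Build O O^o (idealM_pred I J) (idealM_closed I J).
Definition idealM I J : ideal O :=
  GRing.SubmodClosed.clone O O^o (idealM_pred I J) _.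

Definition idealX I (n : nat) : ideal O := iter n (idealM I) idealT.

Definition finitely_generated I : Prop :=
  exists s : seq O, I =i \big[idealD/ideal0]_(a <- s) principal a.

Definition prime_ideal P : Prop :=
  proper_submod P /\ prime_idealr_closed (P : {pred O}).

Definition maximal_ideal P : Prop :=
  proper_submod P /\
  forall J, {subset P <= J} -> J =i P \/ J =i idealT.

End Ideals.
Arguments ideal0 {O}.
Arguments idealT {O}.

(* Fields are not excluded; a vector space has no proper co-torsion subspace. *)
Record dedekind_domain (O : idomainType) : Prop := {
  dedekind_noetherian : forall I : ideal O, finitely_generated I;
  dedekind_int_closed : forall z : {fraction O},
    integralOver (@tofrac O) z -> exists a : O, z = tofrac a;
  dedekind_dim1 : forall P : ideal O,
    prime_ideal P -> ~ (P =i ideal0) -> maximal_ideal P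
}.

Section ProjectiveLine.
Variable O : comNzRingType.
Implicit Type I : ideal O.

Definition unimodular (x : O * O) : Prop :=
  idealD (principal x.1) (principal x.2) =i idealT.

Definition proj_equiv I (x y : O * O) : Prop := x.1 * y.2 - x.2 * y.1 \in I.

Lemma proj_equiv_refl I x : proj_equiv I x x.
Proof. by rewrite /proj_equiv mulrC subrr; apply: (rpred0 I). Qed.

Lemma proj_equiv_sym I x y : proj_equiv I x y -> proj_equiv I y x.
Proof.
move=> /(@rpredZ O O^o I (-1)); rewrite /proj_equiv.
suff -> : y.1 * x.2 - y.2 * x.1 = -1 * (x.1 * y.2 - x.2 * y.1) by [].
by rewrite mulN1r opprB (mulrC x.2) (mulrC x.1).
Qed.

Lemma proj_equiv_trans I x y z : unimodular y ->
  proj_equiv I x y -> proj_equiv I y z -> proj_equiv I x z.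
Proof.
case: x y z => [a b] [c d] [e f] cd; rewrite /proj_equiv /= => xy yz.
have : 1 \in idealD (principal c) (principal d) by rewrite cd.
case/asboolP=> _ [_ [/asboolP[u ->] /asboolP[v ->] uv]].
have -> : a * f - b * e =
    (u * a + v * b) * (c * f - d * e) + (u * e + v * f) * (a * d - b * c).
  by rewrite -[LHS]mul1r uv; ring.
apply: (@rpredD O^o I).
  exact: (@rpredZ O O^o I (u * a + v * b) _ yz).
exact: (@rpredZ O O^o I (u * e + v * f) _ xy).
Qed.

(* The class [a : b] of a unimodular pair.  Classes are plain sets of pairs, so
   that points of the projective lines of two equal ideals can be compared. *)
Definition proj_class I (a b : O) : set (O * O) :=
  [set y | unimodular y /\ proj_equiv I (a, b) y].

Lemma proj_classP I a b c d : unimodular (a, b) -> unimodular (c, d) ->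
  proj_class I a b = proj_class I c d <-> proj_equiv I (a, b) (c, d).
Proof.
move=> uab ucd; split=> [e|e].
  have : proj_class I c d (c, d) by split=> //; exact: proj_equiv_refl.
  by rewrite -e => -[].
apply/seteqP; split=> y [uy ey]; split=> //.
  by apply: proj_equiv_trans ey => //; apply: proj_equiv_sym.
exact: proj_equiv_trans e ey.
Qed.

Definition PF1 I : set (set (O * O)) :=
  [set p | exists a b : O, unimodular (a, b) /\ p = proj_class I a b].

End ProjectiveLine.

Section Invariants.
Variable O : idomainType.

Definition free2 : lmodType O := (O^o * O^o)%type.

Record divisor_data := DivisorData {
  dd_size : nat;
  dd_max : 'I_dd_size -> ideal O;
  dd_l : 'I_dd_size -> nat;
  dd_k : 'I_dd_size -> nat
}.
Arguments dd_max : clear implicits.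
Arguments dd_l : clear implicits.
Arguments dd_k : clear implicits.

Definition elementary_divisors (M : submodClosed free2) (D : divisor_data) :=
  [/\ forall i, maximal_ideal (dd_max D i),
      forall i j, dd_max D i =i dd_max D j -> i = j,
      forall i, (dd_l D i <= dd_k D i)%N /\ dd_k D i <> 0%N
    & lmod_isomorphic (quotmod M)
        (dirsum (fun i : 'I_(dd_size D) =>
           (quotmod (idealX (dd_max D i) (dd_l D i)) *
            quotmod (idealX (dd_max D i) (dd_k D i)))%type : lmodType O))].

Definition ideal_prod (D : divisor_data) (e : 'I_(dd_size D) -> nat) : ideal O :=
  \big[@idealM O/idealT]_(i < dd_size D) idealX (dd_max D i) (e i).

Definition invL (D : divisor_data) : ideal O := ideal_prod (dd_l D).
Definition invK (D : divisor_data) : ideal O := ideal_prod (dd_k D).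
Definition invI (D : divisor_data) : ideal O :=
  ideal_prod (fun i => (dd_k D i - dd_l D i)%N).

(* The points of PF1 (invI D) that are the invariant of M; there is exactly
   one when D is the elementary divisor data of M. *)
Definition projective_invariant (M : submodClosed free2) (D : divisor_data) :
    set (set (O * O)) :=
  PF1 (invI D) `&` [set p | exists a b t : O,
    [/\ unimodular (a, b),
        t \in invL D,
        (forall i, t \notin idealM (invL D) (dd_max D i)),
        (t * a, t * b) \in M
      & p = proj_class (invI D) a b]].

End Invariants.

(* Main.v *)
From HB Require Import structures.
Require Import Defs.
From mathcomp Require Import all_boot all_order all_algebra.
From mathcomp Require Import ring boolp classical_sets.

(* If t in L \ U_i L M_i and (ta, tb) in M, then
     M = { (x, y) in L^2 | x b - y a in K }.
   This is checked at each M_i through the coordinates of O^2/M: the inclusion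
   of M in L^2 is a determinant argument modulo M_i^l, and if be_1, be_2 are the
   coordinates modulo M_i^k of the standard basis, then
   t (a be_1 + b be_2) in M_i^k forces a be_1 + b be_2 in M_i^(k-l).  The latter
   is the only use of the Dedekind property, in the form that M_i is locally
   principal.  The right-hand side depends only on L, K and [a : b].
   Conversely K is the annihilator of O^2/M, L consists of the c with
   c (a, b) in M, and comparing two such descriptions of M gives
   t (a b' - b a') in K, that is a b' - b a' in I. *)

Set Implicit Arguments.
Unset Strict Implicit.
Unset Printing Implicit Defensive.

Import GRing.Theory.
Local Open Scope ring_scope.

(** * Sums, products and powers of ideals; maximal ideals; comaximality *)

Section IdealArithmetic.
Variable O : comNzRingType.
Implicit Types (I J P : ideal O) (x y z : O).

Definition ideal_of (p : pred O^o) (hp : subsemimod_closed p) : ideal O :=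
  HB.pack p (GRing.isSubmodClosed.Build O O^o p hp).

Lemma mem_ideal0 I : (0 : O) \in I.
Proof. exact: (rpred0 I). Qed.

Lemma mem_idealT x : x \in (idealT : ideal O).
Proof. by []. Qed.

Lemma mem_idealD I x y : x \in I -> y \in I -> x + y \in I.
Proof. exact: (@rpredD O^o I x y). Qed.

Lemma mem_idealMl I x y : y \in I -> x * y \in I.
Proof. exact: (@rpredZ O O^o I x y). Qed.

Lemma mem_idealMr I x y : x \in I -> x * y \in I.
Proof. by rewrite mulrC; exact: mem_idealMl. Qed.

Lemma mem_idealN I x : x \in I -> - x \in I.
Proof. by rewrite -mulN1r; exact: mem_idealMl. Qed.

Lemma mem_idealB I x y : x \in I -> y \in I -> x - y \in I.
Proof. by move=> xI /mem_idealN; exact: mem_idealD. Qed.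

Lemma mem_principal a x : reflect (exists c, x = c * a) (x \in principal a).
Proof. exact: asboolP. Qed.

Lemma idealDP I J x :
  reflect (exists u v : O, [/\ u \in I, v \in J & x = u + v]) (x \in idealD I J).
Proof. exact: asboolP. Qed.

Lemma idealM_mem I J x y : x \in I -> y \in J -> x * y \in idealM I J.
Proof.
move=> xI yJ; apply/asboolP; exists [:: (x, y)]; rewrite big_seq1; split=> // p.
by rewrite inE => /eqP->.
Qed.

Lemma idealM_sub I J P : (forall x y, x \in I -> y \in J -> x * y \in P) ->
  {subset idealM I J <= P}.
Proof.
move=> IJP _ /asboolP[s [sIJ ->]].
elim: s sIJ => [|p s IHs] sIJ; first by rewrite big_nil mem_ideal0.
rewrite big_cons mem_idealD //.
  by have [] := sIJ p (mem_head _ _); apply: IJP.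
by apply: IHs => q qs; apply: sIJ; rewrite inE qs orbT.
Qed.

(* Lets idealM_sub be applied to conclusions of the form x * y \in P. *)
Definition colon_pred P y (x : O^o) : bool := (x : O) * y \in P.
Lemma colon_closed P y : subsemimod_closed (colon_pred P y).
Proof.
split; first split.
- by rewrite unfold_in /colon_pred mul0r mem_ideal0.
- by move=> u v uP vP; rewrite unfold_in /colon_pred mulrDl mem_idealD.
- by move=> a u uP; rewrite unfold_in /colon_pred -mulrA mem_idealMl.
Qed.
Definition colon P y : ideal O := ideal_of (colon_closed P y).

Lemma mem_colon P y x : (x \in colon P y) = (x * y \in P).
Proof. by []. Qed.

Lemma idealX_mul I i j x y :
  x \in idealX I i -> y \in idealX I j -> x * y \in idealX I (i + j).
Proof.
move=> xI yI; rewrite -mem_colon; elim: i x xI => [|i IHi] x.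
  by move=> _; rewrite mem_colon mem_idealMl.
apply: idealM_sub => u v uI vI; rewrite mem_colon -mulrA.
by apply: idealM_mem => //; rewrite -mem_colon; apply: IHi.
Qed.

Lemma idealX_le I i j : (i <= j)%N -> {subset idealX I j <= idealX I i}.
Proof.
move=> /subnK <-; elim: (j - i)%N => [//|n IHn] x.
by apply: idealM_sub => u v _ /IHn; apply: mem_idealMl.
Qed.

Lemma idealX1 I x : x \in I -> x \in idealX I 1.
Proof. by move=> xI; rewrite -[x]mulr1; apply: idealM_mem. Qed.

Lemma idealX1E I x : (x \in idealX I 1) = (x \in I).
Proof.
apply/idP/idP; last exact: idealX1.
by apply: idealM_sub => u v uI _; apply: mem_idealMr.
Qed.

Lemma idealX_exp I n x : x \in I -> x ^+ n \in idealX I n.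
Proof.
move=> xI; elim: n => [|n IHn]; first exact: mem_idealT.
by rewrite exprS; exact: (idealM_mem xI IHn).
Qed.

(** Some combination of [a] and [b] equals 1, and the same combination of [a * x] and [b * x] is
    [x]. *)
Lemma unimodular_mem I a b x : unimodular (a, b) ->
  a * x \in I -> b * x \in I -> x \in I.
Proof.
move=> uab ax bx.
have /idealDP[_ [_ [/mem_principal[c ->] /mem_principal[d ->] e]]] :
  1 \in idealD (principal a) (principal b) by rewrite (uab 1) mem_idealT.
by rewrite -[x]mul1r e mulrDl -!mulrA mem_idealD // mem_idealMl.
Qed.

Lemma maximal_inv P s : maximal_ideal P -> s \notin P ->
  exists r, 1 - r * s \in P.
Proof.
move=> [_ Pmax] sP.
have [] := Pmax (idealD P (principal s)).
- by move=> x xP; apply/idealDP; exists x, 0; split; rewrite ?addr0 ?mem_ideal0.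
- move=> e; case/negP: sP; rewrite -e; apply/idealDP; exists 0, s.
  by split; rewrite ?add0r ?mem_ideal0 //; apply/mem_principal; exists 1; rewrite mul1r.
move=> /(_ 1); rewrite mem_idealT => /idealDP[u [_ [uP /mem_principal[r ->] ->]]].
by exists r; rewrite addrK.
Qed.

Lemma maximal_1 P : maximal_ideal P -> 1 \notin P.
Proof.
by move=> [[x xP] _]; apply: contra xP => P1; rewrite -[x]mulr1 mem_idealMl.
Qed.

Lemma sub1X_mem I x n : 1 - x \in I -> 1 - x ^+ n \in I.
Proof.
move=> xI; rewrite -opprB subrX1 -mulNr opprB; exact: mem_idealMr.
Qed.

(** With [r] an inverse of [s] modulo [P], the power [(1 - r * s) ^+ n] lies in [P ^ n] and is 1
    modulo [s], hence has the form [1 - w * s]. *)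
Lemma maximal_invX P s n : maximal_ideal P -> s \notin P ->
  exists r, 1 - r * s \in idealX P n.
Proof.
move=> Pmax /(maximal_inv Pmax)[r rP].
have : 1 - (1 - r * s) ^+ n \in principal s.
  by apply: sub1X_mem; rewrite subKr; apply/mem_principal; exists r.
case/mem_principal=> w e; exists w; rewrite -e subKr; exact: idealX_exp.
Qed.

Lemma maximal_primary P s x n : maximal_ideal P -> s \notin P ->
  s * x \in idealX P n -> x \in idealX P n.
Proof.
move=> Pmax sP sx; have [r rP] := maximal_invX n Pmax sP.
have -> : x = (1 - r * s) * x + r * (s * x) by ring.
by apply: mem_idealD; [exact: mem_idealMr | exact: mem_idealMl].
Qed.

Lemma maximal_notinM P u v : maximal_ideal P ->
  u \notin P -> v \notin P -> u * v \notin P.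
Proof.
move=> Pmax uP vP; apply: contra vP => uv.
by rewrite -idealX1E; apply: maximal_primary uP _; rewrite ?idealX1E.
Qed.

Lemma maximal_notinX P u n : maximal_ideal P -> u \notin P -> u ^+ n \notin P.
Proof.
move=> Pmax uP; elim: n => [|n IHn]; first by rewrite expr0 maximal_1.
by rewrite exprS maximal_notinM.
Qed.

(** This is I + J = O, stated through the Chinese remainder element: 0 modulo [J] and 1 modulo
    [I]. *)
Definition comaximal I J := exists2 v, v \in J & 1 - v \in I.

Lemma maximal_comaximal P Q : maximal_ideal P -> maximal_ideal Q ->
  ~ (P =i Q) -> comaximal P Q.
Proof.
move=> Pmax Qmax PQ.
have /existsNP[s /not_implyP[sQ sP]] : ~ {subset Q <= P}.
  move=> QP; have [_ Qm] := Qmax; have [//|PT] := Qm P QP.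
  by have := maximal_1 Pmax; rewrite PT.
have /negP/(maximal_inv Pmax)[r rP] := sP.
by exists (r * s); first exact: mem_idealMl.
Qed.

Lemma comaximalX I J i j : comaximal I J -> comaximal (idealX I i) (idealX J j).
Proof.
(* [v ^+ j] lies in [J ^ j] and is still 1 modulo [I]; then [(1 - v ^+ j) ^+ i] lies in [I ^ i] and
   is still 1 modulo [J ^ j]. *)
case=> v vJ vI; exists (1 - (1 - v ^+ j) ^+ i); last first.
  by rewrite subKr; apply: idealX_exp; apply: sub1X_mem.
by apply: sub1X_mem; rewrite subKr; apply: idealX_exp.
Qed.

Lemma comaximal_family n (I : ideal O) (J : 'I_n -> ideal O) (A : pred 'I_n) :
  (forall j, A j -> comaximal I (J j)) ->
  exists2 v, 1 - v \in I & forall j, A j -> v \in J j.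
Proof.
move=> IJ.
have /choice[w wP] : forall j, exists v, A j -> v \in J j /\ 1 - v \in I.
  move=> j; have [/IJ[v]|//] := boolP (A j); first by exists v.
  by exists 0.
exists (\prod_(j | A j) w j).
  apply: (big_ind (fun v => 1 - v \in I)) => [|x y xI yI|j /wP[]//].
    by rewrite subrr mem_ideal0.
  have -> : 1 - x * y = (1 - x) + x * (1 - y) by ring.
  by rewrite mem_idealD ?mem_idealMl.
by move=> j Aj; rewrite (bigD1 j) //= mem_idealMr //; case: (wP j Aj).
Qed.

(** Pairwise comaximal ideals have product equal to intersection. By induction, with [v] equal to 1
    modulo the first ideal and 0 modulo all others, both terms of [(1 - v) * x + x * v] lie in the
    product. *)
Lemma big_idealM_cap n (J : 'I_n -> ideal O) x :
  (forall i j, i != j -> comaximal (J i) (J j)) ->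
  x \in \big[@idealM O/idealT]_j J j <-> forall j, x \in J j.
Proof.
elim: n J x => [|n IHn] J x JJ.
  by rewrite big_ord0; split=> [_ []|].
have {}IHn y : y \in \big[@idealM O/idealT]_(j < n) J (lift ord0 j) <->
    forall j, y \in J (lift ord0 j).
  by apply: IHn => i j ij; apply: JJ; rewrite (inj_eq lift_inj).
rewrite big_ord_recl; split=> [|xJ].
  suff sub j : {subset idealM (J ord0)
      (\big[@idealM O/idealT]_(j < n) J (lift ord0 j)) <= J j}.
    by move=> xJ j; exact: sub.
  apply: idealM_sub => u v uJ /IHn vJ.
  case: (unliftP ord0 j) => [k|] ->; first exact: mem_idealMl.
  exact: mem_idealMr.
have [|v v1 vJ] := @comaximal_family n.+1 (J ord0) J (fun j => j != ord0).
  by move=> j j0; apply: JJ; rewrite eq_sym.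
have -> : x = (1 - v) * x + x * v by ring.
apply: mem_idealD; apply: idealM_mem => //; apply/IHn => j //.
by apply: vJ; rewrite eq_sym neq_lift.
Qed.

End IdealArithmetic.

(** * Products of powers of the elementary maximal ideals, read off at each one *)

Section DivisorData.
Variables (O : idomainType) (D : divisor_data O).
Hypothesis Dmax : forall i : 'I_(dd_size D), maximal_ideal (dd_max i).
Hypothesis Dinj : forall i j : 'I_(dd_size D), dd_max i =i dd_max j -> i = j.

Lemma dd_comaximal (i j : 'I_(dd_size D)) (a b : nat) : i != j ->
  comaximal (idealX (dd_max i) a) (idealX (dd_max j) b).
Proof.
move=> ij; apply/comaximalX/maximal_comaximal => // /Dinj e.
by rewrite e eqxx in ij.
Qed.

Lemma ideal_prodP (e : 'I_(dd_size D) -> nat) (x : O) :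
  x \in ideal_prod e <-> forall i, x \in idealX (dd_max i) (e i).
Proof. by apply: big_idealM_cap => i j; apply: dd_comaximal. Qed.

(** The condition on [t] bounds its order at [dd_max i] by [e i]. Take [v] equal to 1 modulo
    [dd_max i] and lying in the required powers of the others. If [t] were in the next power, then
    both [t * (1 - v)] and [t * v] would lie in the excluded product. *)
Lemma notin_idealXS (e : 'I_(dd_size D) -> nat) i (t : O) :
  t \in ideal_prod e -> t \notin idealM (ideal_prod e) (dd_max i) ->
  t \notin idealX (dd_max i) (e i).+1.
Proof.
move=> te; apply: contra.
have [|v v1 vJ] := @comaximal_family _ _ (dd_max i)
  (fun j => idealX (dd_max j) (e j)) (fun j => j != i).
  move=> j; rewrite eq_sym => /(@dd_comaximal i j 1 (e j))[w wj wi].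
  by exists w; rewrite // -idealX1E.
move=> tX; have -> : t = t * (1 - v) + t * v by ring.
apply: mem_idealD; first exact: idealM_mem.
rewrite -mem_colon; move: {te} t tX; apply: idealM_sub => a b am bm.
rewrite mem_colon -mulrA mulrC; apply: idealM_mem => //; apply/ideal_prodP => j.
have [->|ji] := eqVneq j i; first exact: mem_idealMr.
by apply: mem_idealMl; apply: vJ.
Qed.

End DivisorData.

(** * Finite generation and maximal members of families of ideals *)

Section Noetherian.
Variable O : comNzRingType.
Implicit Types (I J P : ideal O) (x y z : O).

Lemma mem_big_principal (s : seq O) x :
  x \in \big[@idealD O/ideal0]_(a <- s) principal a <->
  exists c : 'I_(size s) -> O, x = \sum_i c i * tnth (in_tuple s) i.
Proof.
elim: s x => [|a s IHs] x; rewrite ?big_nil ?big_cons.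
  split=> [/eqP->|[c ->]]; first by exists (fun=> 0); rewrite big_ord0.
  by rewrite big_ord0 mem_ideal0.
split=> [/idealDP[_ [v [/mem_principal[c ->] /IHs[d ->] ->]]]|[c ->]].
  exists (fun i => if unlift ord0 i is Some j then d j else c).
  rewrite big_ord_recl unlift_none (tnth_nth 0) /=; congr (_ + _).
  by apply: eq_bigr => j _; rewrite liftK !(tnth_nth 0).
rewrite big_ord_recl; apply/idealDP; do 2!eexists; split; last by [].
  by apply/mem_principal; eexists; rewrite (tnth_nth 0).
apply/IHs; exists (fun i => c (lift ord0 i)).
by apply: eq_bigr => j _; rewrite !(tnth_nth 0).
Qed.

Lemma finitely_generatedP I : finitely_generated I ->
  exists n (g : 'I_n -> O), (forall i, g i \in I) /\
    (forall x, x \in I -> exists c : 'I_n -> O, x = \sum_i c i * g i).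
Proof.
case=> s Is; exists (size s), (tnth (in_tuple s)); split=> [i|x].
  rewrite Is; apply/mem_big_principal; exists (fun j => (j == i)%:R).
  by rewrite (bigD1 i) //= eqxx mul1r big1 ?addr0 // => j /negbTE->; rewrite mul0r.
by rewrite Is => /mem_big_principal.
Qed.

Lemma mem_ideal_sum n I (F : 'I_n -> O) :
  (forall i, F i \in I) -> \sum_i F i \in I.
Proof.
move=> FI; apply: (big_ind (fun x => x \in I)) => // [|x y].
  exact: mem_ideal0.
exact: mem_idealD.
Qed.

(** Without a maximal member, choice builds a strictly increasing chain [g]. Its union is finitely
    generated, so all generators lie in one stage and the chain cannot grow there. *)
Lemma noetherian_max (S : ideal O -> Prop) :
  (forall I, finitely_generated I) -> (exists I, S I) ->
  exists2 I, S I & forall J, S J -> {subset I <= J} -> {subset J <= I}.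
Proof.
move=> fg [I0 SI0]; apply: contrapT => nomax.
have /choice[f fP] : forall I, exists J, S I ->
    [/\ S J, {subset I <= J} & ~ {subset J <= I}].
  move=> I; have [SI|nSI] := pselect (S I); last by exists I.
  apply: contrapT => nJ; apply: nomax; exists I => // J SJ IJ.
  by apply: contrapT => JI; apply: nJ; exists J.
pose g n := iter n f I0.
have Sg n : S (g n) by elim: n => //= n /fP[].
have gS n : {subset g n <= g n.+1} by have [] := fP _ (Sg n).
have gmono i j : (i <= j)%N -> {subset g i <= g j}.
  move=> /subnK <-; elim: (j - i)%N => [//|k IHk] x /IHk; exact: gS.
have hU : subsemimod_closed (fun x : O^o => `[< exists n, (x : O) \in g n >]).
  split; first split.
  - by apply/asboolP; exists 0; exact: mem_ideal0.
  - move=> x y /asboolP[i xi] /asboolP[j yj]; apply/asboolP; exists (maxn i j).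
    apply: mem_idealD; first by apply: gmono xi; exact: leq_maxl.
    by apply: gmono yj; exact: leq_maxr.
  - move=> a x /asboolP[i xi]; apply/asboolP; exists i; exact: mem_idealMl.
have [n [e [eU Ue]]] := finitely_generatedP (fg (ideal_of hU)).
have /choice[h hP] : forall i, exists k, e i \in g k by move=> i; apply/asboolP/eU.
have [_ _ []] := fP _ (Sg (\max_i h i)); move=> x xg.
have /Ue[c ->] : x \in ideal_of hU by apply/asboolP; exists (\max_i h i).+1.
apply: mem_ideal_sum => i; apply: mem_idealMl; apply: gmono (hP i).
exact: leq_bigmax.
Qed.

End Noetherian.

(** * Maximal ideals of a Dedekind domain are locally principal, which allows division by elements
    of known order *)

Section Dedekind.
Variable O : idomainType.
Hypothesis hO : dedekind_domain O.
Variable P : ideal O.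
Hypothesis Pmax : maximal_ideal P.

(* The ideal (a : c) of the localization at P, contracted to O. *)
Definition local_colon_pred (a c : O) (x : O^o) : bool :=
  `[< exists z d : O, z \notin P /\ z * c * x = d * a >].
Lemma local_colon_closed a c : subsemimod_closed (local_colon_pred a c).
Proof.
split; first split.
- by apply/asboolP; exists 1, 0; rewrite maximal_1 // mulr0 mul0r.
- move=> x y /asboolP[z [d [zP e]]] /asboolP[z' [d' [zP' e']]].
  apply/asboolP; exists (z * z'), (z' * d + z * d').
  split; first exact: maximal_notinM.
  transitivity (z' * (z * c * (x : O)) + z * (z' * c * (y : O))); first by ring.
  by rewrite e e'; ring.
- move=> b x /asboolP[z [d [zP e]]]; apply/asboolP; exists z, (b * d); split=> //.
  by change (z * c * (b * (x : O)) = b * d * a); rewrite mulrCA e mulrA.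
Qed.
Definition local_colon a c : ideal O := ideal_of (local_colon_closed a c).

Lemma local_colonP a c x :
  reflect (exists z d : O, z \notin P /\ z * c * x = d * a) (x \in local_colon a c).
Proof. exact: asboolP. Qed.

(** A member [x] outside [P] could be absorbed into the denominator [z], which would put 1 in the
    colon. *)
Lemma local_colon_sub a c : 1 \notin local_colon a c -> {subset local_colon a c <= P}.
Proof.
move=> c1 x /local_colonP[z [d [zP e]]]; apply: contraNT c1 => xP.
apply/local_colonP; exists (z * x), d; split; first exact: maximal_notinM.
by rewrite -e; ring.
Qed.

(** A maximal proper colon (a : c) is prime: if it contains [x * y] but not [x], then (a : c x) is
    proper and contains it, hence equals it, and contains [y]. It contains [a], so it is nonzero and
    thus maximal; being inside [P], it is [P]. *)
Lemma local_colon_max (a : O) : a \in P -> a != 0 ->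
  exists2 c, 1 \notin local_colon a c & P =i local_colon a c.
Proof.
move=> aP a0.
have [||_ [c -> c1] cmax] := @noetherian_max O
    (fun I => exists2 c, I = local_colon a c & 1 \notin local_colon a c).
- exact: dedekind_noetherian hO.
- exists (local_colon a 1), 1 => //; apply/local_colonP => -[z [d [zP]]].
  by rewrite !mulr1 => e; case/negP: zP; rewrite e mem_idealMl.
exists c => //.
have aC : a \in local_colon a c.
  by apply/local_colonP; exists 1, c; rewrite maximal_1 // mul1r.
have Cprime : prime_ideal (local_colon a c).
  split; first by exists 1.
  move=> x y xy; have [xC|xC] := boolP (x \in local_colon a c) => //=.
  apply: (cmax (local_colon a (c * x))).
  - exists (c * x) => //; apply: contra xC => /local_colonP[z [d [zP e]]].
    by apply/local_colonP; exists z, d; split; rewrite // -e; ring.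
  - move=> w /local_colonP[z [d [zP e]]]; apply/local_colonP; exists z, (x * d).
    by split=> //; rewrite -[x * d * a]mulrA -e; ring.
  - move/local_colonP: xy => [z [d [zP e]]]; apply/local_colonP; exists z, d.
    by split=> //; rewrite -e; ring.
have C0 : ~ (local_colon a c =i ideal0).
  by move=> /(_ a); rewrite aC => /esym a_0; rewrite [a == 0]a_0 in a0.
have [_ Cmax] := dedekind_dim1 hO Cprime C0.
have [//|PT] := Cmax P (local_colon_sub c1).
by have := maximal_1 Pmax; rewrite PT.
Qed.

(** Clearing the denominators of the generators turns [c] into [b] with b P inside a O but [b] not
    in a O. If some [x] in [P] has [b * x = d * a] with [d] outside [P], then [x] generates [P]
    after inverting [d]. Otherwise b P lies in a P, so b / a is integral by the determinant trick,
    hence in O, contradicting the choice of [b]. *)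
Lemma dedekind_locally_principal a : a \in P -> a != 0 ->
  exists p u : O, [/\ p \in P, u \notin P
    & forall x, x \in P -> exists y, u * x = y * p].
Proof.
move=> aP a0; have [c c1 Pc] := local_colon_max aP a0.
have [n [g [gP Pg]]] := finitely_generatedP (dedekind_noetherian hO P).
have /choice[z zP] : forall i, exists z, z \notin P /\ exists d, z * c * g i = d * a.
  move=> i; have := gP i; rewrite Pc => /local_colonP[z [d [zP e]]].
  by exists z; split=> //; exists d.
pose b := (\prod_i z i) * c.
have bP x : x \in P -> exists d, b * x = d * a.
  move=> /Pg[e ->]; apply/mem_principal; rewrite mulr_sumr.
  apply: mem_ideal_sum => i; rewrite mulrCA; apply: mem_idealMl.
  have [_ [d dE]] := zP i; apply/mem_principal.
  exists (\prod_(j | j != i) z j * d).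
  by rewrite -[RHS]mulrA -dE /b (bigD1 i) //=; ring.
have nb e : b != e * a.
  apply: contra c1 => /eqP be; apply/local_colonP.
  exists (\prod_i z i), e; split; last by rewrite mulr1.
  apply: (big_ind (fun z => z \notin P)) => [|x y|i _].
  - exact: maximal_1.
  - exact: maximal_notinM.
  - by case: (zP i).
apply: contrapT => nP.
have bPP x : x \in P -> exists2 d, d \in P & b * x = d * a.
  move=> xP; have [d dE] := bP x xP; exists d => //.
  apply: contrapT => /negP dP; apply: nP; exists x, d; split=> // y yP.
  have [d' dE'] := bP y yP; exists d'; apply: (mulfI a0).
  by rewrite mulrA [a * d]mulrC -dE mulrA [a * d']mulrC -dE'; ring.
have /choice[A AP] : forall i, exists A : 'I_n -> O,
    b * g i = (\sum_j A j * g j) * a.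
  move=> i; have [d /Pg[A ->] e] := bPP _ (gP i).
  by exists A.
pose f := @tofrac O.
have fa0 : f a != 0 by rewrite tofrac_eq0.
(* The transpose of the coefficients [A], since [eigenvalue] refers to row vectors: the row of
   generators has eigenvalue b / a. *)
pose M : 'M[O]_n := \matrix_(i, j) A j i.
have : integralOver f (f b / f a).
  exists (char_poly M); first exact: char_poly_monic.
  rewrite map_char_poly -eigenvalue_root_char; apply/eigenvalueP.
  exists (\row_i f (g i)).
    apply/rowP => j; rewrite !mxE.
    apply: (mulIf fa0); rewrite mulrAC divfK // -rmorphM AP rmorphM; congr (_ * _).
    rewrite rmorph_sum; apply: eq_bigr => i _; rewrite !mxE -rmorphM.
    by rewrite mulrC.
  (* The eigenvector is nonzero because [a] is a nonzero combination of its entries. *)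
  apply: contraNneq a0 => /rowP g0; have [e ->] := Pg a aP.
  rewrite big1 // => i _; have /eqP := g0 i; rewrite !mxE tofrac_eq0 => /eqP->.
  by rewrite mulr0.
case/(dedekind_int_closed hO) => e /(congr1 (fun x => x * f a)).
rewrite divfK // -rmorphM => /eqP; rewrite tofrac_eq; exact/negP/nb.
Qed.

Lemma idealX_local_generator p u n x :
  (forall x, x \in P -> exists y, u * x = y * p) ->
  x \in idealX P n -> exists y, u ^+ n * x = y * p ^+ n.
Proof.
move=> Pp xn; apply/mem_principal; rewrite mulrC -mem_colon.
elim: n x xn => [|n IHn] x.
  by move=> _; rewrite mem_colon; apply/mem_principal; exists x; rewrite !expr0.
apply: idealM_sub => a b /Pp[y yE] /IHn; rewrite !mem_colon => /mem_principal[z zE].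
apply/mem_principal; exists (y * z).
transitivity ((u * a) * (b * u ^+ n)); first by rewrite exprS; ring.
by rewrite yE zE exprS; ring.
Qed.

(** A valuation argument: [t] has order exactly [l], so [x] has order at least [k - l]. With a local
    generator [p], write [u ^+ l * t = t' * p ^+ l], where [t'] is outside [P]; cancelling [p ^+ l]
    in the corresponding equation for [x * t] leaves [x] times an element outside [P]. *)
Lemma dedekind_idealX_div l k (t x : O) :
  t \in idealX P l -> t \notin idealX P l.+1 -> x * t \in idealX P k ->
  x \in idealX P (k - l).
Proof.
move=> tl tl1 xtk.
have [lk|/ltnW] := leqP l k; last by rewrite -subn_eq0 => /eqP->; exact: mem_idealT.
(* For [l = 0], [t] is outside [P] and primality suffices; for [l > 0], [t] itself is the nonzero
   element of [P] that yields a local generator. *)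
have [l0|l0] := posnP l.
  move: tl1 xtk; rewrite l0 subn0 idealX1E mulrC; exact: maximal_primary.
have tP : t \in P by rewrite -idealX1E; exact: idealX_le tl.
have t0 : t != 0 by apply: contraNneq tl1 => ->; exact: mem_ideal0.
have [p [u [pP uP up]]] := dedekind_locally_principal tP t0.
have p0 : p != 0.
  have [y uty] := up t tP; apply: contraNneq uP => p0.
  by move/eqP: uty; rewrite p0 mulr0 mulf_eq0 (negbTE t0) orbF => /eqP->; exact: mem_ideal0.
have [t' tE] := idealX_local_generator up tl.
have [w wE] := idealX_local_generator up xtk.
have t'P : t' \notin P.
  apply: contra tl1 => t'P; apply: maximal_primary (maximal_notinX l Pmax uP) _ => //.
  by rewrite tE; apply: idealM_mem => //; exact: idealX_exp.
apply: (@maximal_primary _ P (u ^+ (k - l) * t')) => //.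
  by apply: maximal_notinM => //; exact: maximal_notinX.
suff -> : u ^+ (k - l) * t' * x = w * p ^+ (k - l).
  by apply: mem_idealMl; exact: idealX_exp.
apply: (mulIf (expf_neq0 l p0)); rewrite -[RHS]mulrA -exprD subnK // -wE.
rewrite -{2}(subnK lk) exprD.
transitivity (u ^+ (k - l) * x * (t' * p ^+ l)); first by ring.
by rewrite -tE; ring.
Qed.

End Dedekind.

(** * Coordinates on O^2/M and the resulting equations for M *)

Lemma quotmod_pi_eq0 (R : pzRingType) (V : lmodType R) (M : submodClosed V) x :
  quotmod_pi M x = 0 <-> x \in M.
Proof.
have <- : quotmod_pi M 0 = 0.
  by apply: (addrI (quotmod_pi M 0)); rewrite -quotmod_piD !addr0.
by rewrite quotmod_piE subr0.
Qed.

(** The [al] and [be] lift the coordinates of the standard basis vectors under the isomorphism.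
    Injectivity gives the congruences that define [M]; surjectivity gives [(y1, y2)] and [(z1, z2)],
    whose coordinates are (1, 0) and (0, 1) at every index at once. *)
Lemma elementary_coordinates (O : idomainType) (M : submodClosed (free2 O))
    (D : divisor_data O) : elementary_divisors M D ->
  exists al1 al2 be1 be2 : 'I_(dd_size D) -> O,
    (forall x1 x2 : O, (x1, x2) \in M <->
      forall i, x1 * al1 i + x2 * al2 i \in idealX (dd_max i) (dd_l i) /\
                x1 * be1 i + x2 * be2 i \in idealX (dd_max i) (dd_k i)) /\
    exists y1 y2 z1 z2 : O, forall i,
      [/\ y1 * al1 i + y2 * al2 i - 1 \in idealX (dd_max i) (dd_l i),
          y1 * be1 i + y2 * be2 i \in idealX (dd_max i) (dd_k i),
          z1 * al1 i + z2 * al2 i \in idealX (dd_max i) (dd_l i)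
        & z1 * be1 i + z2 * be2 i - 1 \in idealX (dd_max i) (dd_k i)].
Proof.
move=> [_ _ _ [f [g fK gK]]].
pose qA (i : 'I_(dd_size D)) := quotmod_pi (idealX (dd_max i) (dd_l i)).
pose qB (i : 'I_(dd_size D)) := quotmod_pi (idealX (dd_max i) (dd_k i)).
pose F (v : free2 O) i := dirsum_coord (f (quotmod_pi M v)) i.
pose e1 : free2 O := (1, 0); pose e2 : free2 O := (0, 1).
have /choice[al1 al1E] : forall i, exists a : O, (F e1 i).1 = qA i a.
  by move=> i; exact: (@quotmod_piP O O^o (idealX (dd_max i) (dd_l i)) (F e1 i).1).
have /choice[al2 al2E] : forall i, exists a : O, (F e2 i).1 = qA i a.
  by move=> i; exact: (@quotmod_piP O O^o (idealX (dd_max i) (dd_l i)) (F e2 i).1).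
have /choice[be1 be1E] : forall i, exists a : O, (F e1 i).2 = qB i a.
  by move=> i; exact: (@quotmod_piP O O^o (idealX (dd_max i) (dd_k i)) (F e1 i).2).
have /choice[be2 be2E] : forall i, exists a : O, (F e2 i).2 = qB i a.
  by move=> i; exact: (@quotmod_piP O O^o (idealX (dd_max i) (dd_k i)) (F e2 i).2).
have FE x1 x2 i : F (x1, x2) i = x1 *: F e1 i + x2 *: F e2 i.
  have -> : ((x1, x2) : free2 O) = x1 *: e1 + x2 *: e2.
    congr pair; first by change (x1 = x1 * 1 + x2 * 0); ring.
    by change (x2 = x1 * 0 + x2 * 1); ring.
  rewrite /F quotmod_piD -!quotmod_scaleE [f _](linearD f).
  rewrite [f (quotmod_scale _ _)](linearZ_LR f) [f (quotmod_scale _ _)](linearZ_LR f).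
  by rewrite dirsum_mkE !dirsum_mkE.
have FA x1 x2 i : (F (x1, x2) i).1 = qA i (x1 * al1 i + x2 * al2 i).
  by rewrite FE /= al1E al2E /qA quotmod_piD -!quotmod_scaleE.
have FB x1 x2 i : (F (x1, x2) i).2 = qB i (x1 * be1 i + x2 * be2 i).
  by rewrite FE /= be1E be2E /qB quotmod_piD -!quotmod_scaleE.
exists al1, al2, be1, be2; split=> [x1 x2|].
  rewrite -quotmod_pi_eq0; split=> [x0 i|xi].
    have F0 : F (x1, x2) i = 0 by rewrite /F x0 (linear0 f) dirsum_mkE.
    by split; apply/quotmod_pi_eq0; rewrite -1?[LHS]FA -1?[LHS]FB F0.
  apply: (can_inj fK); rewrite (linear0 f); apply: dirsumP => i.
  rewrite [RHS]dirsum_mkE -/(F _ i) [F _ _]surjective_pairing FA FB.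
  by have [/quotmod_pi_eq0 A /quotmod_pi_eq0 B] := xi i; congr pair.
have hit (a b : O) : exists y1 y2 : O, forall i,
    y1 * al1 i + y2 * al2 i - a \in idealX (dd_max i) (dd_l i) /\
    y1 * be1 i + y2 * be2 i - b \in idealX (dd_max i) (dd_k i).
  have [[y1 y2] yE] := quotmod_piP (g (dirsum_mk (fun i => (qA i a, qB i b)))).
  exists y1, y2 => i.
  have Fy : F (y1, y2) i = (qA i a, qB i b) by rewrite /F -yE gK dirsum_mkE.
  by split; apply/quotmod_piE; rewrite -1?[LHS]FA -1?[LHS]FB Fy.
have [y1 [y2 yP]] := hit 1 0; have [z1 [z2 zP]] := hit 0 1.
exists y1, y2, z1, z2 => i.
by have := yP i; have := zP i; rewrite !subr0 => -[? ?] [? ?].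
Qed.

(** This makes K intrinsic to [M]. For the converse, [c] is applied to [(z1, z2)], whose last
    coordinate is 1 modulo each [dd_max i ^ dd_k i]. *)
Lemma elementary_ann (O : idomainType) (M : submodClosed (free2 O))
    (D : divisor_data O) (c : O) : elementary_divisors M D ->
  c \in invK D <-> forall x1 x2, (c * x1, c * x2) \in M.
Proof.
move=> hD; have [Dmax Dinj lk _] := hD.
have [al1 [al2 [be1 [be2 [ME [y1 [y2 [z1 [z2 zP]]]]]]]]] := elementary_coordinates hD.
split=> [cK x1 x2|cM].
  apply/ME => i; have /(ideal_prodP Dmax Dinj)/(_ i) ci := cK.
  have ci' : c \in idealX (dd_max i) (dd_l i) by apply: idealX_le ci; case: (lk i).
  by rewrite -!mulrA -!mulrDr; split; apply: mem_idealMr.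
apply/(ideal_prodP Dmax Dinj) => i; have [_ _ _ z1P] := zP i.
have /ME/(_ i)[_ cz] := cM z1 z2.
have -> : c = (c * z1 * be1 i + c * z2 * be2 i) - c * (z1 * be1 i + z2 * be2 i - 1).
  by ring.
by apply: mem_idealB => //; apply: mem_idealMl.
Qed.

(* Since M contains t (a, b), M is locally spanned by t (a, b) and K e for any
   complement e of (a, b). *)
Lemma elementary_mem (O : idomainType) (hO : dedekind_domain O)
    (M : submodClosed (free2 O)) (D : divisor_data O) (a b t : O) :
  elementary_divisors M D -> unimodular (a, b) ->
  t \in invL D -> (forall i : 'I_(dd_size D), t \notin idealM (invL D) (dd_max i)) ->
  (t * a, t * b) \in M ->
  forall x1 x2 : O, (x1, x2) \in M <->
    [/\ x1 \in invL D, x2 \in invL D & x1 * b - x2 * a \in invK D].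
Proof.
move=> hD uab tL tLm tM x1 x2; have [Dmax Dinj lk _] := hD.
have [al1 [al2 [be1 [be2 [ME [y1 [y2 [z1 [z2 yzP]]]]]]]]] := elementary_coordinates hD.
have abB i : a * be1 i + b * be2 i \in idealX (dd_max i) (dd_k i - dd_l i).
  apply: (@dedekind_idealX_div _ hO _ (Dmax i) _ _ t).
  - by move/(ideal_prodP Dmax Dinj): tL.
  - exact: (notin_idealXS Dmax Dinj tL).
  - have /ME/(_ i)[_ tB] := tM.
    by have -> : (a * be1 i + b * be2 i) * t = t * a * be1 i + t * b * be2 i by ring.
have xabB (x : O) i : x \in idealX (dd_max i) (dd_l i) ->
    x * (a * be1 i + b * be2 i) \in idealX (dd_max i) (dd_k i).
  by move=> xl; rewrite -(subnKC (proj1 (lk i))); apply: idealX_mul.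
split=> [/ME xM|[/(ideal_prodP Dmax Dinj) x1L /(ideal_prodP Dmax Dinj) x2L
    /(ideal_prodP Dmax Dinj) xK]].
  have xL (i : 'I_(dd_size D)) :
      x1 \in idealX (dd_max i) (dd_l i) /\ x2 \in idealX (dd_max i) (dd_l i).
    have [xA /(idealX_le (proj1 (lk i))) xB] := xM i.
    have [yA /(idealX_le (proj1 (lk i))) yB zA /(idealX_le (proj1 (lk i))) zB] := yzP i.
    (* Modulo the [dd_l i]-th power, the coordinate matrix has inverse given by [y] and [z], so [d]
       is a unit there and Cramer's rule recovers [x1] and [x2] from their coordinates. *)
    pose d := al1 i * be2 i - al2 i * be1 i.
    have d1 : (y1 * z2 - y2 * z1) * d - 1 \in idealX (dd_max i) (dd_l i).
      have -> : (y1 * z2 - y2 * z1) * d - 1 =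
          (y1 * al1 i + y2 * al2 i - 1) * (z1 * be1 i + z2 * be2 i)
          + (z1 * be1 i + z2 * be2 i - 1)
          - (y1 * be1 i + y2 * be2 i) * (z1 * al1 i + z2 * al2 i) by rewrite /d; ring.
      by apply: mem_idealB; rewrite ?mem_idealMl // mem_idealD // mem_idealMr.
    have cancel x : x * d \in idealX (dd_max i) (dd_l i) ->
        x \in idealX (dd_max i) (dd_l i).
      move=> xd; have -> : x = (y1 * z2 - y2 * z1) * (x * d)
          - x * ((y1 * z2 - y2 * z1) * d - 1) by ring.
      by apply: mem_idealB; apply: mem_idealMl.
    split; apply: cancel.
      have -> : x1 * d = be2 i * (x1 * al1 i + x2 * al2 i)
          - al2 i * (x1 * be1 i + x2 * be2 i) by rewrite /d; ring.
      by apply: mem_idealB; apply: mem_idealMl.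
    have -> : x2 * d = al1 i * (x1 * be1 i + x2 * be2 i)
        - be1 i * (x1 * al1 i + x2 * al2 i) by rewrite /d; ring.
    by apply: mem_idealB; apply: mem_idealMl.
  split; apply/(ideal_prodP Dmax Dinj) => i; [by case: (xL i) | by case: (xL i) |].
  have [/xabB x1B /xabB x2B] := xL i; have [_ xB] := xM i.
  have [_ _ _ zB] := yzP i.
  (* The multiples by [be1 i] and [be2 i] suffice, because [z1 * be1 i + z2 * be2 i] is 1 modulo the
     [dd_k i]-th power. *)
  have e1 : (x1 * b - x2 * a) * be1 i \in idealX (dd_max i) (dd_k i).
    have -> : (x1 * b - x2 * a) * be1 i = b * (x1 * be1 i + x2 * be2 i)
      - x2 * (a * be1 i + b * be2 i) by ring.
    by apply: mem_idealB => //; apply: mem_idealMl.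
  have e2 : (x1 * b - x2 * a) * be2 i \in idealX (dd_max i) (dd_k i).
    have -> : (x1 * b - x2 * a) * be2 i = x1 * (a * be1 i + b * be2 i)
      - a * (x1 * be1 i + x2 * be2 i) by ring.
    by apply: mem_idealB => //; apply: mem_idealMl.
  have -> : x1 * b - x2 * a = z1 * ((x1 * b - x2 * a) * be1 i)
      + z2 * ((x1 * b - x2 * a) * be2 i)
      - (x1 * b - x2 * a) * (z1 * be1 i + z2 * be2 i - 1) by ring.
  apply: mem_idealB; last exact: mem_idealMl.
  by apply: mem_idealD; apply: mem_idealMl.
apply/ME => i; split; first by apply: mem_idealD; apply: mem_idealMr.
apply: (unimodular_mem uab).
  have -> : a * (x1 * be1 i + x2 * be2 i) = x1 * (a * be1 i + b * be2 i)
    - be2 i * (x1 * b - x2 * a) by ring.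
  by apply: mem_idealB; [exact: xabB | exact: mem_idealMl].
have -> : b * (x1 * be1 i + x2 * be2 i) = x2 * (a * be1 i + b * be2 i)
  + be1 i * (x1 * b - x2 * a) by ring.
by apply: mem_idealD; [exact: xabB | exact: mem_idealMl].
Qed.

(** * Passing between L, K and I, and the comparison of two submodules *)

Lemma invK_mul (O : idomainType) (M : submodClosed (free2 O)) (D : divisor_data O)
    (x y : O) : elementary_divisors M D ->
  x \in invL D -> y \in invI D -> x * y \in invK D.
Proof.
move=> [Dmax Dinj lk _] /(ideal_prodP Dmax Dinj) xL /(ideal_prodP Dmax Dinj) yI.
apply/(ideal_prodP Dmax Dinj) => i.
by rewrite -(subnKC (proj1 (lk i))); apply: idealX_mul.
Qed.

(** The order of [t] at each maximal ideal is exactly [dd_l i], so division by [t] lowers the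
    exponent from [dd_k i] to [dd_k i - dd_l i]. With [invK_mul], this recovers I from L and K. *)
Lemma invI_div (O : idomainType) (hO : dedekind_domain O)
    (M : submodClosed (free2 O)) (D : divisor_data O) (t x : O) :
  elementary_divisors M D ->
  t \in invL D -> (forall i : 'I_(dd_size D), t \notin idealM (invL D) (dd_max i)) ->
  x * t \in invK D -> x \in invI D.
Proof.
move=> [Dmax Dinj lk _] tL tLm /(ideal_prodP Dmax Dinj) xt.
apply/(ideal_prodP Dmax Dinj) => i.
apply: (dedekind_idealX_div hO (Dmax i) _ _ (xt i)).
  by move/(ideal_prodP Dmax Dinj): tL.
exact: (notin_idealXS Dmax Dinj tL).
Qed.

Lemma eq_proj_class (O : comNzRingType) (I J : ideal O) (a b : O) :
  I =i J -> proj_class I a b = proj_class J a b.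
Proof.
move=> IJ; apply/seteqP; split=> y [uy]; rewrite /proj_equiv => ey; split=> //.
  by rewrite /proj_equiv -IJ.
by rewrite /proj_equiv IJ.
Qed.

(** The first conjunct says that the common ideal J exists, so that the equality of classes in the
    second is an equality of points of one projective line. *)
Theorem mainTheorem1 (O : idomainType) (hO : dedekind_domain O)
    (M1 M2 : submodClosed (free2 O))
    (hM1 : proper_submod M1) (hM2 : proper_submod M2)
    (tM1 : cotorsion M1) (tM2 : cotorsion M2)
    (D1 D2 : divisor_data O)
    (hD1 : elementary_divisors M1 D1) (hD2 : elementary_divisors M2 D2)
    (a1 b1 a2 b2 : O)
    (u1 : unimodular (a1, b1)) (u2 : unimodular (a2, b2))
    (p1 : projective_invariant M1 D1 (proj_class (invI D1) a1 b1))
    (p2 : projective_invariant M2 D2 (proj_class (invI D2) a2 b2)) :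
  (invL D1 =i invL D2 -> invK D1 =i invK D2 -> invI D1 =i invI D2) /\
  (M1 =i M2 <->
   [/\ invL D1 =i invL D2,
       invK D1 =i invK D2
     & proj_class (invI D1) a1 b1 = proj_class (invI D2) a2 b2]).
Proof.
(* The multiple by [t1] is known to be in [M1] only for some representative [(c1, d1)] of the class,
   so it replaces [(a1, b1)] from here on. *)
have [_ [c1 [d1 [t1 [v1 t1L t1Lm t1M E1]]]]] := p1.
have [_ [c2 [d2 [t2 [v2 t2L t2Lm t2M E2]]]]] := p2.
have ME1 := elementary_mem hO hD1 v1 t1L t1Lm t1M.
have ME2 := elementary_mem hO hD2 v2 t2L t2Lm t2M.
have II : invL D1 =i invL D2 -> invK D1 =i invK D2 -> invI D1 =i invI D2.
  move=> LL KK x; apply/idP/idP => xI.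
    apply: (invI_div hO hD2 t2L t2Lm); rewrite -KK mulrC.
    by apply: (invK_mul hD1) xI; rewrite LL.
  apply: (invI_div hO hD1 t1L t1Lm); rewrite KK mulrC.
  by apply: (invK_mul hD2) xI; rewrite -LL.
split=> //; rewrite E1 E2; split=> [MM|[LL KK EE]].
  have KK : invK D1 =i invK D2.
    move=> c; apply/idP/idP => /elementary_ann.
      by move=> /(_ _ hD1) cM; apply/(elementary_ann _ hD2) => x y; rewrite -MM.
    by move=> /(_ _ hD2) cM; apply/(elementary_ann _ hD1) => x y; rewrite MM.
  have L_mem D (c d x : O) : x \in invL D ->
      [/\ x * c \in invL D, x * d \in invL D & x * c * d - x * d * c \in invK D].
    move=> xL; split; try exact: mem_idealMr.
    have -> : x * c * d - x * d * c = 0 by ring.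
    exact: mem_ideal0.
  (* For [x] in L, the multiple of the representative by [x] lies in both submodules, so its entries
     lie in the other L, and unimodularity removes the representative. *)
  have LL : invL D1 =i invL D2.
    move=> x; apply/idP/idP => xL.
      have /ME1 := L_mem _ c1 d1 _ xL; rewrite MM => /ME2[xc xd _].
      by apply: (unimodular_mem v1); rewrite mulrC.
    have /ME2 := L_mem _ c2 d2 _ xL; rewrite -MM => /ME1[xc xd _].
    by apply: (unimodular_mem v2); rewrite mulrC.
  split=> //.
  rewrite -(eq_proj_class c2 d2 (II LL KK)); apply/proj_classP => //.
  apply: (invI_div hO hD1 t1L t1Lm).
  have := t1M; rewrite MM KK /= => /ME2[_ _ cdK].
  by have -> : (c1 * d2 - d1 * c2) * t1 = t1 * c1 * d2 - t1 * d1 * c2 by ring.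
move: EE; rewrite -(eq_proj_class c2 d2 (II LL KK)) => /proj_classP.
move=> /(_ v1 v2); rewrite /proj_equiv /= => cd.
have cdK x : x \in invL D1 -> x * (c1 * d2 - d1 * c2) \in invK D1.
  by move=> xL; apply: (invK_mul hD1).
case=> x1 x2; apply/idP/idP.
  move/ME1=> [x1L x2L xK]; apply/ME2; rewrite -!LL -KK; split=> //.
  (* Multiplied by [c1] or [d1], the linear form of [M2] becomes a multiple of that of [M1] plus an
     element of L I, which lies in K. *)
  apply: (unimodular_mem v1).
    have -> : c1 * (x1 * d2 - x2 * c2) = x1 * (c1 * d2 - d1 * c2)
      + c2 * (x1 * d1 - x2 * c1) by ring.
    by apply: mem_idealD; [exact: cdK | exact: mem_idealMl].
  have -> : d1 * (x1 * d2 - x2 * c2) = x2 * (c1 * d2 - d1 * c2)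
    + d2 * (x1 * d1 - x2 * c1) by ring.
  by apply: mem_idealD; [exact: cdK | exact: mem_idealMl].
move/ME2; rewrite -!LL -KK => -[x1L x2L xK]; apply/ME1; split=> //.
apply: (unimodular_mem v2).
  have -> : c2 * (x1 * d1 - x2 * c1) = c1 * (x1 * d2 - x2 * c2)
    - x1 * (c1 * d2 - d1 * c2) by ring.
  by apply: mem_idealB; [exact: mem_idealMl | exact: cdK].
have -> : d2 * (x1 * d1 - x2 * c1) = d1 * (x1 * d2 - x2 * c2)
  - x2 * (c1 * d2 - d1 * c2) by ring.
by apply: mem_idealB; [exact: mem_idealMl | exact: cdK].
Qed.
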